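(* The VC-dimension of the class of polytopes with at most $k$ vertices in $\mathbb R^d$ is at most $8d^2k\log_2 k$.
   Context: For a set $X$ and a collection $\mathcal F\subset 2^X$ of subsets of $X$ (where $2^X$ is the power set of $X$), a set $Y\subset X$ is shattered by $\mathcal F$ if for any $Y'\subset Y$ there is $F'\in\mathcal F$ such that $F'\cap Y=Y'$. The VC-dimension of $\mathcal F$ is the size of the largest subset $Y$ of $X$ shattered by $\mathcal F$. Here $X=\mathbb R^d$, and $\mathcal F$ is the collection of all polytopes in $\mathbb R^d$ with at most $k$ vertices, i.e. convex hulls of at most $k$ points of $\mathbb R^d$.
   Formalization: The formal theorem assumes d ≥ 1 and k ≥ 2: for k = 1 or d = 0 the bound 8d²k log₂ k is 0 although a single point is shattered (by a point and the empty polytope), and for k = 0 the logarithm is undefined. *)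

(* Defs.v *)
From mathcomp Require Import all_boot all_order all_algebra.
From mathcomp Require Import all_classical all_reals all_analysis.

Set Implicit Arguments.
Unset Strict Implicit.
Unset Printing Implicit Defensive.

Import Order.TTheory GRing.Theory Num.Theory.
Local Open Scope classical_set_scope.
Local Open Scope ring_scope.

Definition shattered (T : Type) (F : set (set T)) (Y : set T) : Prop :=
  forall Y' : set T, Y' `<=` Y -> exists2 F', F F' & F' `&` Y = Y'.

(* [counting Y] is the number of elements of [Y], or [+oo] if [Y] is infinite.
   The supremum is the size of a largest shattered set when there is one, and
   [+oo] when the shattered sets have unbounded size. *)
Definition VC_dim (R : realType) (T : choiceType) (F : set (set T)) : \bar R :=
  ereal_sup [set counting Y | Y in [set Y : set T | shattered F Y]].

Definition convex_hull (R : realType) (E : lmodType R) (V : set E) : set E :=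
  smallest (@convex_set R E) V.

(* [V] ranges over the sets of at most [k] points, so the empty polytope
   (no vertex) and the degenerate polytopes are included. *)
Definition polytopes (R : realType) (d k : nat) : set (set 'rV[R]_d) :=
  [set convex_hull V | V in [set V : set 'rV[R]_d | (V #<= `I_k)%card]].

Definition log2 (R : realType) (x : R) : R := ln x / ln 2.

(* Main.v *)
Require Import Defs.
From mathcomp Require Import all_boot all_order all_fingroup all_algebra.
From mathcomp Require Import all_classical all_reals all_analysis.
From mathcomp Require Import ring lra zify.

(* By Caratheodory's theorem and Cramer's rule for Gram matrices, whether y lies
   in the convex hull of v_1, ..., v_k is decided by the signs of about k^(d+1)
   polynomials of degree at most 2k in the kd coordinates of the v_i, so the
   number 2^n of traces on a shattered set of n points is bounded by a number of
   sign patterns. Sign patterns are counted a la Warren: if P is the product of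
   the polynomials, each strict sign pattern is attained at a local maximum of
   s P - eps (sum_i x_i^(E+1)) for s = 1 or s = -1, with E odd and E >= deg P. The
   critical points satisfy equations x_i^E = q_i(x) with deg q_i < E, and these
   have at most E^N solutions because every polynomial is equal on the solution
   set to a combination of monomials with all exponents below E. For d >= 2 the
   resulting inequality gives the bound, and for d = 1 no three points are
   shattered. *)

Set Implicit Arguments.
Unset Strict Implicit.
Unset Printing Implicit Defensive.
Import Order.TTheory GRing.Theory Num.Theory numFieldNormedType.Exports.
Local Open Scope classical_set_scope.
Local Open Scope ring_scope.

(** * Polynomial functions *)

Section PolyFun.
Context {R : comNzRingType} {N : nat}.
Implicit Types (f g : 'rV[R]_N -> R) (w : seq 'I_N) (s t : nat).

Definition monomial w (x : 'rV[R]_N) : R := \prod_(i <- w) x 0 i.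

(* Linear combinations of monomials of degree strictly less than [s]: [polyfun 0]
   contains only 0, and derivation maps [polyfun s.+1] to [polyfun s] for all [s]. *)
Definition polyfun s f : Prop :=
  exists2 r : seq (R * seq 'I_N), all (fun cw => size cw.2 < s)%N r &
    forall x, f x = \sum_(cw <- r) cw.1 * monomial cw.2 x.

Lemma eq_polyfun s f g : f =1 g -> polyfun s f -> polyfun s g.
Proof. by move=> fg [r rs fE]; exists r => // x; rewrite -fg. Qed.

Lemma polyfun_leq s t f : (s <= t)%N -> polyfun s f -> polyfun t f.
Proof.
move=> st [r rs fE]; exists r => //; apply: sub_all rs => cw /= cws.
exact: leq_trans cws st.
Qed.

(** Induction on the list of terms; extensionality of [Q] is assumed because the representation in
    [polyfun] is only pointwise. *)
Lemma polyfun_ind s (Q : ('rV[R]_N -> R) -> Prop) :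
  (forall f g, f =1 g -> Q f -> Q g) -> Q (fun=> 0) ->
  (forall c w f, (size w < s)%N -> Q f -> Q (fun x => c * monomial w x + f x)) ->
  forall f, polyfun s f -> Q f.
Proof.
move=> Qext Q0 QD f [r]; elim: r f => [|[c w] r IHr] f /=.
  by move=> _ fE; apply: Qext Q0 => x; rewrite fE big_nil.
move=> /andP[ws rs] fE.
by apply: Qext (QD c w _ ws (IHr _ rs (fun=> erefl))) => x; rewrite fE big_cons.
Qed.

Lemma polyfun0 s : polyfun s (fun=> 0).
Proof. by exists [::] => // x; rewrite big_nil. Qed.

Lemma polyfun_monomial s c w : (size w < s)%N -> polyfun s (fun x => c * monomial w x).
Proof. by move=> ws; exists [:: (c, w)] => [/=|x]; rewrite ?ws // big_seq1. Qed.

Lemma polyfun_cst s c : polyfun s.+1 (fun=> c).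
Proof.
apply: eq_polyfun (@polyfun_monomial s.+1 c [::] _) => // x.
by rewrite /monomial big_nil mulr1.
Qed.

Lemma polyfun_coord i : polyfun 2 (fun x => x 0 i).
Proof.
apply: eq_polyfun (@polyfun_monomial 2 1 [:: i] _) => // x.
by rewrite /monomial big_seq1 mul1r.
Qed.

Lemma polyfunD s f g : polyfun s f -> polyfun s g -> polyfun s (fun x => f x + g x).
Proof.
move=> [r rs fE] [r' rs' gE]; exists (r ++ r') => [|x]; first by rewrite all_cat rs.
by rewrite big_cat fE gE.
Qed.

Lemma monomial_cat w w' x : monomial (w ++ w') x = monomial w x * monomial w' x.
Proof. by rewrite /monomial big_cat. Qed.

Lemma polyfunM s t f g : polyfun s.+1 f -> polyfun t.+1 g ->
  polyfun (s + t).+1 (fun x => f x * g x).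
Proof.
move=> Pf Pg; move: f Pf; apply: polyfun_ind => [f1 f2 fE| |c w f1 ws Pf1].
- by apply: eq_polyfun => x; rewrite fE.
- by apply: eq_polyfun (polyfun0 _) => x; rewrite mul0r.
- suff Pwg : polyfun (s + t).+1 (fun x => c * monomial w x * g x).
    by apply: eq_polyfun (polyfunD Pwg Pf1) => x; rewrite mulrDl.
  move: g Pg {Pf1}; apply: polyfun_ind => [g1 g2 gE| |c' w' g1 ws' Pg1].
  + by apply: eq_polyfun => x; rewrite gE.
  + by apply: eq_polyfun (polyfun0 _) => x; rewrite mulr0.
  + have ww : (size (w ++ w') < (s + t).+1)%N by rewrite size_cat ltnS leq_add.
    apply: eq_polyfun (polyfunD (polyfun_monomial (c * c') ww) Pg1) => x.
    by rewrite monomial_cat mulrDr mulrACA.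
Qed.

Lemma polyfunZ s c f : polyfun s f -> polyfun s (fun x => c * f x).
Proof.
case: s => [[[|//] _ fE]|s Pf]; last exact: (polyfunM (polyfun_cst 0 c) Pf).
by exists [::] => // x; rewrite fE !big_nil mulr0.
Qed.

Lemma polyfunN s f : polyfun s f -> polyfun s (fun x => - f x).
Proof. by move/(polyfunZ (-1)); apply: eq_polyfun => x; rewrite mulN1r. Qed.

Lemma polyfunB s f g : polyfun s f -> polyfun s g -> polyfun s (fun x => f x - g x).
Proof. by move=> Pf /polyfunN; exact: polyfunD. Qed.

Lemma polyfun_sum s (I : Type) (r : seq I) (P : pred I) (F : I -> 'rV[R]_N -> R) :
  (forall i, P i -> polyfun s (F i)) -> polyfun s (fun x => \sum_(i <- r | P i) F i x).
Proof.
move=> PF; elim: r => [|i r IHr].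
  by apply: eq_polyfun (polyfun0 s) => x; rewrite big_nil.
have [Pi|nPi] := boolP (P i).
  by apply: eq_polyfun (polyfunD (PF i Pi) IHr) => x; rewrite big_cons Pi.
by apply: eq_polyfun IHr => x; rewrite big_cons (negPf nPi).
Qed.

Lemma polyfun_prod s (I : Type) (r : seq I) (F : I -> 'rV[R]_N -> R) :
  (forall i, polyfun s.+1 (F i)) ->
  polyfun (size r * s).+1 (fun x => \prod_(i <- r) F i x).
Proof.
move=> PF; elim: r => [|i r IHr].
  by apply: eq_polyfun (polyfun_cst 0 1) => x; rewrite big_nil.
by rewrite mulSn; apply: eq_polyfun (polyfunM (PF i) IHr) => x; rewrite big_cons.
Qed.

Lemma polyfunX s n f : polyfun s.+1 f -> polyfun (n * s).+1 (fun x => f x ^+ n).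
Proof.
move=> Pf; have := polyfun_prod (nseq n tt) (fun=> Pf); rewrite size_nseq.
by apply: eq_polyfun => x; rewrite big_nseq iter_mulr_1.
Qed.

Lemma monomialE w x : monomial w x = \prod_i x 0 i ^+ count_mem i w.
Proof.
elim: w => [|i w IHw]; first by rewrite /monomial big_nil big1.
rewrite /monomial big_cons -/(monomial w x) IHw (bigD1 i) //= [RHS](bigD1 i) //=.
rewrite eqxx mulrA exprS; congr (_ * _); apply: eq_bigr => j ji.
by rewrite eq_sym (negPf ji).
Qed.

Lemma monomial_split w i E : (E <= count_mem i w)%N ->
  exists2 w', size w = (E + size w')%N &
    forall x, monomial w x = x 0 i ^+ E * monomial w' x.
Proof.
move=> Ew; pose w' := nseq (count_mem i w - E) i ++ seq.filter (predC1 i) w.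
have ww' : perm_eq w (nseq E i ++ w').
  rewrite /w' catA -nseqD subnKC // -size_filter.
  have /all_pred1P <- := filter_all (pred1 i) w.
  by rewrite perm_sym; apply/permPl/perm_filterC.
exists w' => [|x]; first by rewrite (perm_size ww') size_cat size_nseq.
rewrite /monomial (perm_big _ ww') big_cat; congr (_ * _).
by rewrite big_nseq iter_mulr_1.
Qed.

End PolyFun.

(* The evaluations at the [p t] of the monomials with exponents below [E] span
   all evaluation vectors, since [x_i ^+ E] can be replaced by [q i], and by
   interpolation the latter are all the vectors. *)
Lemma card_zeros_leq (F : fieldType) (N E : nat) (T : finType)
    (p : T -> 'rV[F]_N) (q : 'I_N -> 'rV[F]_N -> F) :
  injective p -> (forall i, polyfun E (q i)) ->
  (forall i t, p t 0 i ^+ E = q i (p t)) -> (#|T| <= E ^ N)%N.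
Proof.
move=> p_inj Pq pq.
pose ev (f : 'rV[F]_N -> F) := \row_(j < #|T|) f (p (enum_val j)).
pose M := \matrix_(a < #|{ffun 'I_N -> 'I_E}|, j < #|T|)
            \prod_i p (enum_val j) 0 i ^+ (enum_val a) i.
have evS s f : polyfun s f -> (ev f <= M)%MS.
  elim/ltn_ind: s f => s IHs; apply: polyfun_ind => [f g fg|| c w f ws fM].
  - by rewrite (_ : ev g = ev f) //; apply/rowP => j; rewrite !mxE fg.
  - by rewrite (_ : ev _ = 0) ?sub0mx //; apply/rowP => j; rewrite !mxE.
  rewrite (_ : ev _ = c *: ev (monomial w) + ev f); last first.
    by apply/rowP => j; rewrite !mxE.
  apply: addmx_sub fM; apply: scalemx_sub.
  have [/existsP[i iw]|/existsPn wE] := boolP [exists i, E <= count_mem i w]%N.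
    have [w' sw' wE] := @monomial_split F _ _ _ _ iw.
    rewrite (_ : ev _ = ev (fun x => q i x * monomial w' x)); last first.
      by apply/rowP => j; rewrite !mxE wE pq.
    apply: (IHs (size w) ws); have := Pq i; rewrite sw'; case: (E) => [|E'] Pqi.
      apply: eq_polyfun (polyfun0 _) => x; case: Pqi => [[|//] _ ->].
      by rewrite big_nil mul0r.
    rewrite addSn; apply: polyfunM Pqi _.
    by apply: eq_polyfun (polyfun_monomial 1 (ltnSn _)) => x; rewrite mul1r.
  have {}wE i : (count_mem i w < E)%N by rewrite ltnNge.
  pose a := [ffun i => Ordinal (wE i)].
  rewrite (_ : ev _ = row (enum_rank a) M) ?row_sub //; apply/rowP => j.
  by rewrite !mxE monomialE; apply: eq_bigr => i _; rewrite enum_rankK ffunE.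
have M_full : (1%:M <= M)%MS.
  apply/row_subP => j; pose t := enum_val j.
  (* Each factor is nonzero at [p t] and, if [u != t], vanishes at [p u]; the product over all [u]
     is a nonzero multiple of the indicator of [t] on the points. *)
  have /fin_all_exists[f /all_and3[f2 ft fu]] (u : T) : exists f : 'rV[F]_N -> F,
      [/\ polyfun 2 f, f (p t) != 0 & u != t -> f (p u) = 0].
    have [->|ut] := eqVneq u t.
      by exists (fun=> 1); split; [exact: polyfun_cst|exact: oner_neq0|].
    have [i pui] : exists i, p t 0 i != p u 0 i.
      apply/existsP; apply: contraNT ut => /existsPn tu; apply/eqP/p_inj.
      by apply/rowP => i; apply/esym/eqP; move: (tu i); rewrite negbK.
    exists (fun x => x 0 i - p u 0 i); split; last by rewrite subrr.
      exact: polyfunB (polyfun_coord i) (polyfun_cst 1 _).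
    by rewrite subr_eq0.
  have := evS _ _ (polyfun_prod (enum T) f2).
  set v := ev _ => vM; have -> : row j 1%:M = (v 0 j)^-1 *: v; last exact: scalemx_sub.
  have vj : v 0 j != 0 by rewrite mxE big_enum; apply/prodf_neq0 => u _; exact: ft.
  apply/rowP => j'; rewrite [in LHS]mxE [in LHS]mxE [in RHS]mxE.
  have [<-|jj'] := eqVneq j j'; first by rewrite mulVf.
  rewrite [v 0 j']mxE big_enum (bigD1 (enum_val j')) //= fu ?mul0r ?mulr0 //.
  by apply: contra_neq jj' => /enum_val_inj.
have := mxrankS M_full; rewrite mxrank1 => /leq_trans -> //.
by rewrite (leq_trans (rank_leq_row M)) // card_ffun !card_ord.
Qed.

(** * Partial derivatives of polynomial functions *)

Section Analysis.
Context {R : realType} {N : nat}.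
Implicit Types (f g : 'rV[R]_N -> R) (w : seq 'I_N) (s t : nat).

(** Quantifying over [t] gives differentiability along the whole line through [x], in the form
    [derive1_at_max] asks for. *)
Definition is_partial (j : 'I_N) f g : Prop := forall x (t : R),
  is_derive t (1 : R) (fun u : R => f (x + u *: delta_mx 0 j)) (g (x + t *: delta_mx 0 j)).

Lemma is_partial_eq j f g f' g' :
  f =1 f' -> g =1 g' -> is_partial j f g -> is_partial j f' g'.
Proof.
move=> ff' gg' H x t; rewrite -gg'.
rewrite (_ : (fun u => f' _) = (fun u : R => f (x + u *: delta_mx 0 j))) //.
by apply/funext => u.
Qed.

Lemma is_partial_cst j c : is_partial j (fun=> c) (fun=> 0).
Proof. by move=> x t; exact: is_derive_cst. Qed.

Lemma is_partialD j f g df dg : is_partial j f df -> is_partial j g dg ->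
  is_partial j (fun x => f x + g x) (fun x => df x + dg x).
Proof. by move=> Hf Hg x t; exact: is_deriveD. Qed.

Lemma is_partialM j f g df dg : is_partial j f df -> is_partial j g dg ->
  is_partial j (fun x => f x * g x) (fun x => df x * g x + f x * dg x).
Proof.
move=> Hf Hg x t; apply: is_derive_eq; first exact: is_deriveM.
by rewrite addrC mulrC.
Qed.

Lemma is_partialZ j c f df : is_partial j f df ->
  is_partial j (fun x => c * f x) (fun x => c * df x).
Proof.
move=> Hf; apply: is_partial_eq (is_partialM (is_partial_cst j c) Hf) => // x.
by rewrite mul0r add0r.
Qed.

Lemma is_partial_coord j i : is_partial j (fun x => x 0 i) (fun=> (i == j)%:R).
Proof.
move=> x t; rewrite (_ : (fun u => _) = (fun u : R => x 0 i + u * (i == j)%:R)); last first.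
  by apply/funext => u; rewrite !mxE eqxx.
apply: is_derive_eq; rewrite add0r.
by rewrite mul1r scaler0 add0r /GRing.scale /= mulr1.
Qed.

Lemma is_partial_sum j (I : Type) (r : seq I) (F dF : I -> 'rV[R]_N -> R) :
  (forall i, is_partial j (F i) (dF i)) ->
  is_partial j (fun x => \sum_(i <- r) F i x) (fun x => \sum_(i <- r) dF i x).
Proof.
move=> HF; elim: r => [|i r IHr].
  by apply: is_partial_eq (is_partial_cst j 0) => x; rewrite big_nil.
by apply: is_partial_eq (is_partialD (HF i) IHr) => x; rewrite big_cons.
Qed.

Lemma is_partialX j n i :
  is_partial j (fun x => x 0 i ^+ n.+1) (fun x => ((i == j)%:R * n.+1%:R) * x 0 i ^+ n).
Proof.
elim: n => [|n IHn].
  by apply: is_partial_eq (is_partial_coord j i) => x; rewrite ?expr1 ?expr0 ?mulr1.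
apply: is_partial_eq (is_partialM (is_partial_coord j i) IHn) => x.
  by rewrite [RHS]exprS.
by rewrite -[n.+2%:R]natr1 !exprS; ring.
Qed.

Lemma polyfun_partial j s f : polyfun s.+1 f ->
  exists2 g, polyfun s g & is_partial j f g.
Proof.
have mono w : exists2 g, polyfun (size w) g & is_partial j (monomial w) g.
  elim: w => [|i w [g Pg Hg]].
    exists (fun=> 0); first exact: polyfun0.
    by apply: is_partial_eq (is_partial_cst j 1) => // x; rewrite /monomial big_nil.
  exists (fun x => (i == j)%:R * monomial w x + x 0 i * g x); last first.
    apply: is_partial_eq (is_partialM (is_partial_coord j i) Hg) => // x.
    by rewrite /monomial big_cons.
  apply: polyfunD; first exact: polyfun_monomial.
  (* For empty [w], [polyfunM] does not apply to [polyfun 0], but then [g] is 0. *)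
  move: Pg => /=; case: (size w) => [[[|//] _ gE]|n Pg]; last first.
    exact: (polyfunM (polyfun_coord i) Pg).
  by apply: eq_polyfun (polyfun0 _) => x; rewrite gE big_nil mulr0.
move: f; apply: polyfun_ind => [f f' ff' [g Pg Hg]||c w f ws [g Pg Hg]].
- by exists g => //; apply: is_partial_eq Hg.
- by exists (fun=> 0); [exact: polyfun0|exact: is_partial_cst].
- have [g' Pg' Hg'] := mono w; exists (fun x => c * g' x + g x).
    by apply: polyfunD Pg; apply: polyfunZ; exact: polyfun_leq Pg'.
  by apply: is_partialD Hg; exact: is_partialZ.
Qed.

Lemma polyfun_continuous s f : polyfun s f -> continuous f.
Proof.
have mono w : continuous (monomial w : 'rV[R]_N -> R).
  elim: w => [|i w IHw] x.
    rewrite (_ : monomial _ = fun=> 1); first exact: cst_continuous.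
    by apply/funext => y; rewrite /monomial big_nil.
  rewrite (_ : monomial _ = (fun y : 'rV[R]_N => y 0 i * monomial w y)); last first.
    by apply/funext => y; rewrite /monomial big_cons.
  by apply: continuousM; [exact: coord_continuous|exact: IHw].
move: f; apply: polyfun_ind => [f f' /funext <- //|x|c w f _ Cf x].
  exact: cst_continuous.
have Cm : continuous (fun y : 'rV[R]_N => c * monomial w y).
  by move=> y; apply: continuousM; [exact: cst_continuous|exact: mono].
exact: cvgD (Cm x) (Cf x).
Qed.

(** [C] is the sum of the absolute values of the coefficients. This growth bound yields coercivity
    below. *)
Lemma polyfun_bound s f : polyfun s.+1 f -> exists2 C : R, 0 <= C &
  forall (x : 'rV[R]_N) (r : R), 1 <= r -> (forall i, `|x 0 i| <= r) ->
    `|f x| <= C * r ^+ s.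
Proof.
move: f; apply: polyfun_ind => [f f' ff' [C C0 HC]||c w f ws [C C0 HC]].
- by exists C => // x r; rewrite -ff'; exact: HC.
- by exists 0 => // x r _ _; rewrite normr0 mul0r.
- exists (`|c| + C) => [|x r r1 xr]; first by rewrite addr_ge0.
  rewrite (le_trans (ler_normD _ _)) // mulrDl lerD ?HC // normrM ler_wpM2l //.
  apply: (@le_trans _ _ (r ^+ size w)); last by rewrite ler_weXn2l.
  rewrite /monomial normr_prod; elim: w {ws} => [|i w IHw] /=.
    by rewrite big_nil expr0.
  by rewrite big_cons exprS ler_pM // prodr_ge0.
Qed.
End Analysis.

(** * Sign patterns *)

Section SignPatterns.
Context {R : realType} {N : nat}.
Implicit Types (P G : 'rV[R]_N -> R) (x p z : 'rV[R]_N).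

(** For odd [E] this is nonnegative, and its [j]-th partial derivative is [E.+1] times the single
    power [x 0 j ^+ E]. *)
Definition even_power_sum E x : R := \sum_i x 0 i ^+ E.+1.

Lemma even_power_sum_ge E x i : odd E -> x 0 i ^+ E.+1 <= even_power_sum E x.
Proof.
move=> oddE; rewrite /even_power_sum (bigD1 i) //= lerDl sumr_ge0 // => j _.
by rewrite exprn_even_ge0 //= oddE.
Qed.

Lemma partial_local_max_eq0 j G dG p : is_partial j G dG ->
  (\forall z \near p, G z <= G p) -> dG p = 0.
Proof.
move=> HG Gmax; pose L (u : R) : 'rV[R]_N := p + u *: delta_mx 0 j.
have L0 : L 0 = p by rewrite /L scale0r addr0.
have Lc : L u @[u --> (0 : R)] --> L 0.
  by apply: cvgD; [exact: cvg_cst|apply: cvgZr_tmp; exact: cvg_id].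
rewrite L0 in Lc.
have /nbhs_ballP[e /= e0 He] := Lc _ Gmax.
have der := derive1_at_max (f := fun u => G (L u)) (a := - e) (b := e) (c := 0).
have := HG p 0; rewrite -/(L 0) L0 => dG0.
have [_ <-] := dG0.
have [|||t te|_ //] := der _ _ _ _.
- by lra.
- by move=> t _; have [] := HG p t.
- by rewrite in_itv /= oppr_lt0 e0.
- rewrite L0; apply: He; rewrite /ball /= sub0r normrN ltr_norml.
  by rewrite in_itv in te.
Qed.

(* [P - eps * even_power_sum E] is coercive and positive at [x0], hence has a
   positive maximum on the closed set where all the [h i] are nonnegative; by the
   last hypothesis it is attained in the interior. *)
Lemma exists_critical_point (I : finType) (h : I -> 'rV[R]_N -> R) P D E eps x0 :
    odd E -> (D <= E)%N -> polyfun D.+1 P -> (forall i, continuous (h i)) -> 0 < eps ->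
    (forall i, 0 < h i x0) -> eps * even_power_sum E x0 < P x0 ->
    (forall z, (forall i, 0 <= h i z) -> 0 < P z -> forall i, 0 < h i z) ->
  exists p, (forall i, 0 < h i p) /\
    forall j dP, is_partial j P dP -> dP p = eps * E.+1%:R * p 0 j ^+ E.
Proof.
move=> oddE DE Pp hc eps0 hx0 Px0 hP.
pose G z := P z - eps * even_power_sum E z.
have PsE : polyfun (E.+1 * 1).+1 (even_power_sum E).
  by apply: polyfun_sum => i _; apply: polyfunX; exact: polyfun_coord.
have Gc : continuous G.
  apply: (@polyfun_continuous _ _ (E.+1 * 1).+1); apply: polyfunB.
    by apply: polyfun_leq Pp; rewrite ltnS muln1 (leq_trans DE).
  exact: polyfunZ.
(* Adding [G] to the constraints makes the feasible set [K] bounded. *)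
pose H (o : option I) := if o is Some i then h i else G.
have Hc o : continuous (H o) by case: o => [i|]; [exact: hc|exact: Gc].
pose K := [set z | forall o, 0 <= H o z].
have Gx0 : 0 < G x0 by rewrite subr_gt0.
have Kx0 : K x0 by move=> [i|] /=; rewrite ltW.
have [C C0 HC] := polyfun_bound Pp.
(* If [r], the largest absolute coordinate of [z], is at least 1, then [0 <= G z] gives
   [eps * r ^+ E.+1 <= P z <= C * r ^+ E], so [r <= C / eps]; the 1 covers smaller [r]. *)
pose B := 1 + C / eps.
have Ksub : K `<=` [set v | forall i, `[- B, B]%classic (v ord0 i)].
  move=> z Kz i /=; rewrite in_itv /= -ler_norml.
  pose i0 := [arg max_(a > i) `|z 0 a|]%O.
  have zi0 a : `|z 0 a| <= `|z 0 i0|.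
    by rewrite /i0; case: arg_maxP => // b _; exact.
  apply: (le_trans (zi0 i)); have [r1|/ltW r1] := leP `|z 0 i0| 1.
    by rewrite (le_trans r1) // lerDl divr_ge0 // ltW.
  set r := `|z 0 i0| in zi0 r1 *.
  rewrite -[leLHS]add0r lerD // ler_pdivlMr // mulrC.
  have rE : 0 < r ^+ E by rewrite exprn_gt0 // (lt_le_trans ltr01).
  rewrite -(ler_pM2r rE) -mulrA -exprS.
  have rP : `|P z| <= C * r ^+ E.
    by rewrite (le_trans (HC _ _ r1 zi0)) // ler_wpM2l // ler_weXn2l.
  apply: le_trans rP; apply: le_trans (ler_norm _).
  have := Kz None; rewrite /= subr_ge0; apply: le_trans.
  rewrite ler_pM2l // (le_trans _ (even_power_sum_ge z i0 oddE)) //.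
  by rewrite -normrX ger0_norm // exprn_even_ge0 //= oddE.
have Kclosed : closed K.
  rewrite (_ : K = \bigcap_(o in setT) (H o @^-1` [set y | 0 <= y])).
    apply: closed_bigI => o _; apply: closed_comp; last exact: closed_ge.
    by move=> z _; exact: Hc.
  by apply/seteqP; split => [z Kz o _|z Kz o]; [exact: Kz|exact: Kz].
have Kcompact : compact K.
  apply: (subclosed_compact Kclosed _ Ksub).
  by apply: (@rV_compact R N (fun=> `[- B, B]%classic)) => i; exact: segment_compact.
have [p] := @EVT_max_rV R N G K (ex_intro _ _ Kx0) Kcompact (continuous_subspaceT Gc).
rewrite inE => Kp Gp.
have Gp0 : 0 < G p by apply: lt_le_trans Gx0 (Gp _ _); rewrite inE.
have Qp0 : 0 <= even_power_sum E p.
  by apply: sumr_ge0 => i _; rewrite exprn_even_ge0 //= oddE.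
have Pp0 : 0 < P p.
  move: Gp0; rewrite subr_gt0; apply: le_lt_trans.
  by rewrite mulr_ge0 // ltW.
have hp := hP p (fun i => Kp (Some i)) Pp0.
have Hp o : 0 < H o p by case: o.
(* All constraints are strict at [p], so a neighborhood of [p] lies in [K] and the maximum over [K]
   is a local one in the whole space. *)
have near_le : \forall z \near p, G z <= G p.
  have pF : Filter (nbhs p) := nbhs_filter (p : 'rV[R]_N).
  have Hnear : \forall z \near p, forall o, 0 < H o z.
    apply: (@filter_forall _ (option I) (fun o z => 0 < H o z) (nbhs p) pF) => o.
    exact: (@cvgr_gt _ _ (nbhs p) pF (H o) (H o p) (Hc o p) 0 (Hp o)).
  apply: (@filterS _ (nbhs p) pF _ _ _ Hnear) => z Hz; apply: Gp.
  by rewrite inE => o; exact: ltW.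
exists p; split=> // j dP HdP.
have HG : is_partial j G (fun z =>
    dP z + (- eps) * \sum_i ((i == j)%:R * E.+1%:R * z 0 i ^+ E)).
  apply: (@is_partial_eq _ _ _ (fun z => P z + (- eps) * even_power_sum E z)) => [z||] //.
    by rewrite mulNr.
  apply: is_partialD HdP _; apply: is_partialZ; apply: is_partial_sum => i.
  exact: is_partialX.
have /eqP := partial_local_max_eq0 HG near_le.
rewrite mulNr subr_eq0 => /eqP ->; rewrite (bigD1 j) //= eqxx mul1r big1 ?addr0 ?mulrA //.
by move=> i /negPf ->; rewrite !mul0r.
Qed.
End SignPatterns.

(** The witness, the inverse of one plus the sum of the inverses, also covers an empty [I]. *)
Lemma exists_pos_lower_bound (R : realFieldType) (I : finType) (a : I -> R) :
  (forall i, 0 < a i) -> exists2 e, 0 < e & forall i, e < a i.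
Proof.
move=> a0; exists (1 + \sum_i (a i)^-1)^-1 => [|i].
  by rewrite invr_gt0 ltr_pwDl // sumr_ge0 // => i _; rewrite invr_ge0 ltW.
rewrite -[ltRHS]invrK ltf_pV2 ?posrE ?invr_gt0 //; last first.
  by rewrite ltr_pwDl // sumr_ge0 // => j _; rewrite invr_ge0 ltW.
rewrite (bigD1 i) //= addrCA ltrDl ltr_pwDl // sumr_ge0 // => j _.
by rewrite invr_ge0 ltW.
Qed.

Section SignPatterns.
Context {R : realType} {N : nat}.
Implicit Types (J T : finType) (D : nat).

(** Each [x t] is traded for a critical point with the same signs. Distinct patterns give distinct
    critical points, which [card_zeros_leq] counts. *)
Lemma card_sign_patterns_prod_gt0 J T (f : J -> 'rV[R]_N -> R) D (s : R)
    (x : T -> 'rV[R]_N) :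
  (forall j, polyfun D.+1 (f j)) ->
  (forall t, 0 < s * \prod_j f j (x t)) ->
  (forall t t', (forall j, (0 < f j (x t)) = (0 < f j (x t'))) -> t = t') ->
  (#|T| <= (#|J| * D).+1 ^ N)%N.
Proof.
move=> Pf fx0 xinj; pose d := (#|J| * D)%N.
have [E [oddE dE Ed]] : exists E, [/\ odd E, (d <= E)%N & (E <= d.+1)%N].
  exists d./2.*2.+1; split; first by rewrite /= odd_double.
    by rewrite -[leqLHS]odd_double_half -add1n leq_add2r leq_b1.
  by rewrite ltnS -[leqRHS]odd_double_half leq_addl.
pose P z := s * \prod_j f j z.
have Pp : polyfun d.+1 P.
  apply: polyfunZ; have := polyfun_prod (enum J) Pf.
  by rewrite -cardE; apply: eq_polyfun => z; rewrite big_enum.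
have Q0 (z : 'rV[R]_N) : 0 < even_power_sum E z + 1 :> R.
  by rewrite ltr_wpDl // sumr_ge0 // => i _; rewrite exprn_even_ge0 //= oddE.
(* A single [eps] must serve all [t], so that all critical points solve the same system; the [+ 1]
   keeps the denominators positive. *)
have [t|eps eps0 Heps] := exists_pos_lower_bound
    (a := fun t => P (x t) / (even_power_sum E (x t) + 1)).
  by apply: divr_gt0; [exact: fx0|exact: Q0].
have P_neq0 z j : 0 < P z -> f j z != 0.
  by apply: contraTneq => fz; rewrite /P (bigD1 j) //= fz mul0r mulr0 ltxx.
have crit t : exists p, (forall j, 0 < f j (x t) * f j p) /\
    forall i dP, is_partial i P dP -> dP p = eps * E.+1%:R * p 0 i ^+ E.
  (* The constraints [f j (x t) * f j z >= 0] keep the signs of [x t] up to zeros, and [P z > 0]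
     excludes zeros. *)
  apply: (@exists_critical_point _ _ _ _ _ d _ _ (x t)) => // [j z|j||z hz Pz j].
  - by apply: continuousM; [exact: cst_continuous|exact: polyfun_continuous (Pf j) _].
  - by rewrite /= -expr2 exprn_even_gt0 //=; exact: P_neq0 (fx0 t).
  - have := Heps t; rewrite ltr_pdivlMr //; apply: le_lt_trans.
    by rewrite ler_pM2l // lerDl.
  - rewrite lt_neqAle (hz j) andbT eq_sym mulf_neq0 //; last exact: P_neq0.
    exact: P_neq0 (fx0 t).
have [p /all_and2[fp dp]] := fin_all_exists crit.
have /fin_all_exists2[dP PdP HdP] i := polyfun_partial i Pp.
have c0 : eps * E.+1%:R != 0 by rewrite mulf_neq0 // gt_eqF.
apply: (@leq_trans (E ^ N)); last by case: (N) => // n; rewrite leq_exp2r.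
apply: (@card_zeros_leq R N E T p (fun i z => (eps * E.+1%:R)^-1 * dP i z)).
- move=> t t' ptt'; apply: xinj => j.
  have := fp t j; have := fp t' j; rewrite ptt'.
  have sgE (a b : R) : 0 < a * b -> (0 < a) = (0 < b).
    have [a0|a0|<-] := ltgtP 0 a; last by rewrite mul0r ltxx.
      by rewrite pmulr_rgt0.
    by rewrite nmulr_rgt0 // => /lt_gtF ->.
  by move=> /sgE -> /sgE ->.
- by move=> i; apply: polyfunZ; exact: polyfun_leq (PdP i).
- by move=> i t; rewrite (dp t i _ (HdP i)) mulKf.
Qed.

(** The factor 2 comes from splitting [T] by the sign of the product of the [f j]. *)
Lemma card_strict_sign_patterns J T (f : J -> 'rV[R]_N -> R) D (x : T -> 'rV[R]_N) :
  (forall j, polyfun D.+1 (f j)) -> (forall j t, f j (x t) != 0) ->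
  (forall t t', (forall j, (0 < f j (x t)) = (0 < f j (x t'))) -> t = t') ->
  (#|T| <= 2 * (#|J| * D).+1 ^ N)%N.
Proof.
move=> Pf fx0 xinj; pose A := [pred t | 0 < \prod_j f j (x t)].
rewrite -(cardC A) mul2n -addnn leq_add //.
- rewrite -[leqLHS]card_sig.
  apply: (card_sign_patterns_prod_gt0 (s := 1)
    (x := fun t : {t | t \in A} => x (val t))) => //.
    by move=> [t At]; rewrite mul1r.
  by move=> t t' tt'; apply/val_inj/xinj.
- rewrite -[leqLHS]card_sig.
  apply: (card_sign_patterns_prod_gt0 (s := -1)
    (x := fun t : {t | t \in [predC A]} => x (val t))) => //.
    move=> [t At]; rewrite mulN1r oppr_gt0 lt_neqAle leNgt.
    by apply/andP; split; [apply/prodf_neq0|].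
  by move=> t t' tt'; apply/val_inj/xinj.
Qed.

(* If [e] is below all the nonzero values [`|f j (x t)|], then the sign of
   [f j (x t)] is determined by the strict signs of [f j (x t) + e] and
   [f j (x t) - e]. *)
Lemma card_sign_patterns J T (f : J -> 'rV[R]_N -> R) D (x : T -> 'rV[R]_N) :
  (forall j, polyfun D.+1 (f j)) ->
  (forall t t', (forall j, Num.sg (f j (x t)) = Num.sg (f j (x t'))) -> t = t') ->
  (#|T| <= 2 * (2 * #|J| * D).+1 ^ N)%N.
Proof.
move=> Pf xinj.
(* Zero values are replaced by 1, so that only the nonzero ones constrain [e]. *)
have [jt|e e0 He] := exists_pos_lower_bound
    (a := fun jt : J * T => if f jt.1 (x jt.2) == 0 then 1 else `|f jt.1 (x jt.2)|).
  by case: ifPn => // fx; rewrite normr_gt0.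
pose g (jb : J * bool) z := f jb.1 z + (-1) ^+ jb.2 * e.
have He' j t : f j (x t) != 0 -> e < `|f j (x t)|.
  by move=> /negPf fx; have := He (j, t); rewrite /= fx.
have g_gt0 j t : (0 < g (j, true) (x t)) = (0 < f j (x t)).
  rewrite /g /= expr1 mulN1r subr_gt0.
  have [->|/He'] := eqVneq (f j (x t)) 0; first by rewrite ltxx lt_gtF.
  by rewrite lter_normr; lra.
have g_ge0 j t : (0 < g (j, false) (x t)) = (0 <= f j (x t)).
  rewrite /g /= expr0 mul1r.
  have [->|/He'] := eqVneq (f j (x t)) 0; first by rewrite add0r e0 lexx.
  by rewrite lter_normr; lra.
have -> : (2 * #|J| = #|{: J * bool}|)%N by rewrite card_prod card_bool mulnC.
apply: (@card_strict_sign_patterns _ _ g D x).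
- by move=> [j b]; apply: polyfunD => //; exact: polyfun_cst.
- move=> [j b] t; rewrite /g /=; have [->|/He'] := eqVneq (f j (x t)) 0.
    by rewrite add0r mulf_neq0 ?signr_eq0 ?gt_eqF.
  by rewrite lter_normr; case: b; rewrite ?expr1 ?expr0; lra.
- move=> t t' tt'; apply: xinj => j.
  have := tt' (j, true); have := tt' (j, false); rewrite !g_gt0 !g_ge0.
  by case: (sgrP (f j (x t))); case: (sgrP (f j (x t'))) => //; lra.
Qed.
End SignPatterns.

(** * Membership in a finitely generated cone *)

Section Cones.
Context {R : realFieldType} {k d : nat}.
Implicit Types (A : 'M[R]_(k, d)) (z : 'rV[R]_d) (T : {set 'I_k}).

Definition in_cone A z : Prop :=
  exists2 l : 'rV[R]_k, (forall i, 0 <= l 0 i) & l *m A = z.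

(** Linear independence of the rows indexed by [T], with coefficient vectors of full length [k]
    supported in [T]. *)
Definition independent_on A T : Prop := forall m : 'rV[R]_k,
  (forall i, i \notin T -> m 0 i = 0) -> m *m A = 0 -> m = 0.

(** Induction on the size of the support: as long as its rows are dependent, subtracting a multiple
    of a relation removes an index. *)
Lemma caratheodory A z : in_cone A z -> exists T, independent_on A T /\
  exists l : 'rV[R]_k, [/\ forall i, 0 <= l 0 i,
    forall i, i \notin T -> l 0 i = 0 & l *m A = z].
Proof.
move=> [l l0 lz]; pose supp (l : 'rV[R]_k) := [set i | l 0 i != 0]%SET.
have [n] := ubnP #|supp l|; elim: n l l0 lz => // n IHn l l0 lz; rewrite ltnS => ln.
have lsupp i : i \notin supp l -> l 0 i = 0 by rewrite inE negbK => /eqP.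
have [ind|/existsNP[m /not_implyP[mS /not_implyP[mA m0]]]] :=
  pselect (independent_on A (supp l)).
  by exists (supp l); split=> //; exists l.
wlog [i0 mi0] : m mS mA m0 / exists i, 0 < m 0 i.
  move=> wl; have [i mi] : exists i, m 0 i != 0.
    apply/existsP; apply: contra_notT m0 => /existsPn mi; apply/rowP => i.
    by rewrite mxE; apply/eqP; move: (mi i); rewrite negbK.
  have [mi0|mi0|/eqP] := ltgtP 0 (m 0 i); last by rewrite eq_sym (negPf mi).
    by apply: wl mS mA m0 _; exists i.
  apply: (wl (- m)) => [j jS|||].
  - by rewrite mxE mS ?oppr0.
  - by rewrite mulNmx mA oppr0.
  - by move/eqP; rewrite oppr_eq0 => /eqP.
  - by exists i; rewrite mxE oppr_gt0.
(* The minimal ratio is the largest multiple of [m] that keeps all coefficients nonnegative; it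
   cancels coefficient [i]. *)
pose i := [arg min_(i < i0 | 0 < m 0 i) (l 0 i / m 0 i)]%O.
have [mi0' imin] : 0 < m 0 i /\ forall j, 0 < m 0 j -> l 0 i / m 0 i <= l 0 j / m 0 j.
  by rewrite /i; case: arg_minP.
pose t := l 0 i / m 0 i.
have t0 : 0 <= t by rewrite divr_ge0 // ltW.
apply: (IHn (l - t *: m)) => [j||].
- rewrite !mxE subr_ge0; have [mj|mj] := ltP 0 (m 0 j).
    by rewrite -ler_pdivlMr //; exact: imin.
  by rewrite (le_trans _ (l0 j)) // mulr_ge0_le0.
- by rewrite mulmxBl -scalemxAl mA scaler0 subr0.
- apply: leq_trans ln; apply: proper_card; apply/properP; split.
    apply/fintype.subsetP => j; apply: contraLR => jS.
    by rewrite !inE !mxE lsupp // mS // mulr0 subrr eqxx.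
  exists i; first rewrite inE.
    by apply: contraTneq mi0' => li; rewrite mS ?ltxx // inE li eqxx.
  by rewrite !inE !mxE /t divfK ?subrr ?eqxx // gt_eqF.
Qed.

Lemma card_independent_on A T : independent_on A T -> (#|T| <= d)%N.
Proof.
move=> indT; pose B := rowsub (enum_val : 'I_#|T| -> 'I_k) A.
suff /eqP <- : row_free B by exact: rank_leq_col.
rewrite -kermx_eq0; apply/eqP/row_matrixP => i; rewrite row0; set x := row i _.
have xB : x *m B = 0 by apply/sub_kermxP; exact: row_sub.
(* The extension of [x] by zero outside [T]. *)
pose m := x *m rowsub (enum_val : 'I_#|T| -> 'I_k) 1%:M : 'rV[R]_k.
have rsE a b : rowsub (enum_val : 'I_#|T| -> 'I_k) 1%:M a b = (enum_val a == b)%:R :> R.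
  by rewrite !mxE.
have mE (j : 'I_#|T|) : m 0 (enum_val j) = x 0 j.
  rewrite /m mxE (bigD1 j) //= rsE eqxx mulr1 big1 ?addr0 // => a aj.
  by rewrite rsE (inj_eq enum_val_inj) (negPf aj) mulr0.
have m0 : m = 0.
  apply: indT => [a aT|]; last by rewrite /m -mulmxA -rowsubE.
  rewrite /m mxE big1 // => j _; rewrite rsE.
  by case: eqP => [ja|_]; [rewrite -ja enum_valP in aT|rewrite mulr0].
by apply/rowP => j; rewrite -mE m0 !mxE.
Qed.

Definition restrict_rows A T : 'M[R]_(k, d) := \matrix_(i, j) (A i j *+ (i \in T)).

(* The diagonal term makes this matrix of fixed size [k] invertible exactly when
   the rows of [A] with index in [T] are independent. *)
Definition gram A T : 'M[R]_k :=
  restrict_rows A T *m (restrict_rows A T)^T +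
    \matrix_(i, j) ((i == j) && (i \notin T))%:R.

(** Cramer numerators of the normal equations [l *m gram A T = z *m (restrict_rows A T)^T]; avoiding
    division keeps them polynomial in [A]. *)
Definition cone_num A z T : 'rV[R]_k := z *m (restrict_rows A T)^T *m \adj (gram A T).

Definition cone_res A z T : 'rV[R]_d :=
  cone_num A z T *m restrict_rows A T - \det (gram A T) *: z.

Definition cone_certificate A z T : Prop :=
  [/\ \det (gram A T) != 0, forall i, 0 <= cone_num A z T 0 i * \det (gram A T) &
      cone_res A z T = 0].

Lemma cone_certificateP A z T : cone_certificate A z T -> in_cone A z.
Proof.
move=> [det0 num0 /eqP]; rewrite subr_eq0 => /eqP res0.
(* The cut-off outside [T] is there because [cone_res] sees only the rows in [T], whereas [in_cone]
   uses all of [A]. *)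
exists (\row_i (cone_num A z T 0 i / \det (gram A T) *+ (i \in T))) => [i|].
  rewrite mxE mulrn_wge0 //; set D := \det _ in det0 num0 *.
  have -> : cone_num A z T 0 i / D = cone_num A z T 0 i * D * D ^- 2 by field.
  by rewrite mulr_ge0 // invr_ge0 sqr_ge0.
apply: (scalerI det0); rewrite -res0; move: (cone_num A z T) (\det _) det0 => v D D0.
apply/rowP => j; rewrite !mxE mulr_sumr; apply: eq_bigr => i _; rewrite !mxE.
case: (i \in T); last by rewrite !mulr0n mul0r !mulr0.
by rewrite !mulr1n; field.
Qed.

Lemma mulmx_restrict_rows A T (l : 'rV[R]_k) :
  (forall i, i \notin T -> l 0 i = 0) -> l *m restrict_rows A T = l *m A.
Proof.
move=> lT; apply/rowP => j; rewrite !mxE; apply: eq_bigr => i _; rewrite mxE.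
by have [//|/lT ->] := boolP (i \in T); rewrite !mul0r.
Qed.

Lemma mulmx_gram A T (l : 'rV[R]_k) : l *m gram A T =
  l *m restrict_rows A T *m (restrict_rows A T)^T + \row_i (l 0 i *+ (i \notin T)).
Proof.
rewrite mulmxDr mulmxA; congr (_ + _); apply/rowP => j; rewrite !mxE (bigD1 j) //=.
rewrite big1 ?addr0 => [|i /negPf ij]; last by rewrite mxE ij mulr0.
by rewrite mxE eqxx mulr_natr.
Qed.

(** A kernel vector [x] is supported in [T] thanks to the diagonal term. Then
    [v = x *m restrict_rows A T] satisfies [v *m v^T = 0], hence [v = 0] and independence
    applies. *)
Lemma det_gram_neq0 A T : independent_on A T -> \det (gram A T) != 0.
Proof.
move=> indT; apply/negP => /det0P[x x0 xM]; case/negP: x0; apply/eqP.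
have xE j : (x *m restrict_rows A T *m (restrict_rows A T)^T) 0 j =
    - (x 0 j *+ (j \notin T)).
  by apply/eqP; rewrite -addr_eq0; move/rowP: xM => /(_ j); rewrite mulmx_gram !mxE => ->.
have xT i : i \notin T -> x 0 i = 0.
  move=> iT; have := xE i; rewrite iT mxE big1 ?mulr1n => [/esym/eqP|j _].
    by rewrite oppr_eq0 => /eqP.
  by rewrite !mxE (negPf iT) mulr0.
apply: indT => //; rewrite -(mulmx_restrict_rows _ xT).
set v := x *m _ in xE *.
have : (v *m v^T) 0 0 = 0.
  rewrite {2}/v trmx_mul mulmxA mxE big1 // => j _; rewrite xE [x^T _ _]mxE.
  by have [_|/xT ->] := boolP (j \in T); rewrite ?mulr0n ?oppr0 ?mul0r ?mulr0.
rewrite mxE => /eqP; rewrite psumr_eq0 => [/allP v0|j _]; last first.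
  by rewrite [v^T _ _]mxE -expr2 sqr_ge0.
apply/rowP => j; have := v0 j (mem_index_enum _).
by rewrite [v^T _ _]mxE -expr2 sqrf_eq0 [RHS]mxE => /eqP.
Qed.

(** For the coefficients [l] given by [caratheodory], the normal equations make [cone_num] equal to
    the determinant times [l]. *)
Lemma exists_cone_certificate A z :
  in_cone A z -> exists T, (#|T| <= d)%N /\ cone_certificate A z T.
Proof.
move=> /caratheodory[T [indT [l [l0 lT lz]]]].
exists T; split; first exact: card_independent_on indT.
have det0 := det_gram_neq0 indT.
have numE : cone_num A z T = \det (gram A T) *: l.
  rewrite /cone_num; have -> : z *m (restrict_rows A T)^T = l *m gram A T.
    rewrite mulmx_gram mulmx_restrict_rows // lz; apply/rowP => j; rewrite [RHS]mxE.
    rewrite [X in _ + X]mxE; have [_|/lT ->] := boolP (j \in T);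
      by rewrite ?mulr0n ?mul0rn addr0.
  by rewrite -mulmxA mul_mx_adj mul_mx_scalar.
split=> // [i|]; first by rewrite numE mxE mulrAC -expr2 mulr_ge0 ?sqr_ge0.
by rewrite /cone_res numE -scalemxAl mulmx_restrict_rows // lz subrr.
Qed.

End Cones.

(** * Cones depending polynomially on parameters *)

Lemma polyfun_det (R : comNzRingType) (N n s : nat) (F : 'rV[R]_N -> 'M[R]_n) :
  (forall i j, polyfun s.+1 (fun x => F x i j)) ->
  polyfun (n * s).+1 (fun x => \det (F x)).
Proof.
move=> PF; apply: polyfun_sum => u _; apply: polyfunZ.
have := polyfun_prod (enum 'I_n) (fun i => PF i (u i)); rewrite size_enum_ord.
by apply: eq_polyfun => x; rewrite big_enum.
Qed.

Lemma polyfun_adj (R : comNzRingType) (N n s : nat) (F : 'rV[R]_N -> 'M[R]_n) i j :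
  (forall i j, polyfun s.+1 (fun x => F x i j)) ->
  polyfun (n.-1 * s).+1 (fun x => (\adj (F x)) i j).
Proof.
move=> PF; apply: (@eq_polyfun _ _ _ (fun x => cofactor (F x) j i)) => [x|].
  by rewrite mxE.
apply: polyfunZ; apply: polyfun_det => a b.
by apply: eq_polyfun (PF (lift j a) (lift i b)) => x; rewrite !mxE.
Qed.

Lemma imset_ord_of_card (I : finType) (T : {set I}) d :
  T != finset.set0 -> (#|T| <= d)%N ->
  exists phi : {ffun 'I_d -> I}, [set phi i | i : 'I_d]%SET = T.
Proof.
(* The default [a] fills the indices beyond [#|T|], which is where [T] must be nonempty. *)
move=> /set0Pn[a aT] Td; exists [ffun i : 'I_d => nth a (enum T) i].
apply/setP => b; apply/imsetP/idP => [[i _ ->]|bT].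
  rewrite ffunE; have [iT|iT] := ltnP i (size (enum T)).
    by rewrite -mem_enum mem_nth.
  by rewrite nth_default.
have bi : (index b (enum T) < d)%N.
  by rewrite (leq_trans _ Td) // cardE index_mem mem_enum.
by exists (Ordinal bi) => //; rewrite ffunE /= nth_index // mem_enum.
Qed.

Section ConeTraces.
Context {R : realType} {N k d n : nat}.
Context (F : 'rV[R]_N -> 'M[R]_(k, d)) (z : 'I_n -> 'rV[R]_d).
Context (k_gt0 : (0 < k)%N) (PF : forall i j, polyfun 2 (fun x => F x i j)).
Context (z_neq0 : forall i, z i != 0).

(* The rows used in a certificate are indexed by the image of a map from ['I_d], so
   that there are [k ^ d] choices instead of all the subsets of ['I_k]. *)
Let J : finType := ({ffun 'I_d -> 'I_k} * option ('I_n * ('I_k + 'I_d)))%type.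

Definition cone_poly (j : J) (x : 'rV[R]_N) : R :=
  let T := [set j.1 i | i : 'I_d]%SET in
  match j.2 with
  | None => \det (gram (F x) T)
  | Some (i, inl a) => cone_num (F x) (z i) T 0 a
  | Some (i, inr b) => cone_res (F x) (z i) T 0 b
  end.

(** Gram entries have degree at most 2, so determinants have degree at most [2 * k], numerators
    [2 * k - 1] and residues [2 * k]. *)
Lemma polyfun_cone_poly j : polyfun (2 * k).+1 (cone_poly j).
Proof.
have PT T a b : polyfun 2 (fun x => restrict_rows (F x) T a b).
  apply: (@eq_polyfun _ _ _ (fun x => (a \in T)%:R * F x a b)) => [x|]; last first.
    exact: polyfunZ.
  by rewrite mxE mulr_natl.
have PG T a b : polyfun 3 (fun x => gram (F x) T a b).
  pose c : R := ((a == b) && (a \notin T))%:R.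
  apply: (@eq_polyfun _ _ _ (fun x =>
    \sum_c restrict_rows (F x) T a c * restrict_rows (F x) T b c + c)) => [x|].
    rewrite [RHS]mxE [X in _ = X + _]mxE [X in _ = _ + X]mxE; congr (_ + _).
    by apply: eq_bigr => i _; rewrite [X in _ = _ * X]mxE.
  apply: polyfunD (polyfun_cst 2 _); apply: polyfun_sum => i _.
  exact: (polyfunM (PT T a i) (PT T b i)).
have Pdet T : polyfun (2 * k).+1 (fun x => \det (gram (F x) T)).
  by rewrite mulnC; exact: polyfun_det.
have Pnum T v a : polyfun (2 * k).-1.+1 (fun x => cone_num (F x) v T 0 a).
  apply: (@eq_polyfun _ _ _ (fun x => \sum_c
     (\sum_e v 0 e * restrict_rows (F x) T c e) * (\adj (gram (F x) T)) c a)) => [x|].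
    rewrite [RHS]mxE; apply: eq_bigr => c _; congr (_ * _).
    by rewrite [RHS]mxE; apply: eq_bigr => e _; rewrite [X in _ = _ * X]mxE.
  apply: polyfun_sum => c _.
  have -> : ((2 * k).-1 = 1 + k.-1 * 2)%N by lia.
  apply: polyfunM; last by apply: polyfun_adj => *; exact: PG.
  by apply: polyfun_sum => e _; exact: polyfunZ.
rewrite /cone_poly; case: j => phi [[i [a|b]]|] /=; last exact: Pdet.
  by apply: polyfun_leq (Pnum _ _ _); lia.
set T := [set _ | _ in _]%SET.
apply: (@eq_polyfun _ _ _ (fun x =>
    \sum_c cone_num (F x) (z i) T 0 c * restrict_rows (F x) T c b -
    z i 0 b * \det (gram (F x) T))) => [x|].
  by rewrite [RHS]mxE [X in _ = X + _]mxE [X in _ = _ + X]mxE [X in _ = _ - X]mxE mulrC.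
apply: polyfunB; last exact: polyfunZ.
apply: polyfun_sum => c _.
have -> : (2 * k = (2 * k).-1 + 1)%N by lia.
exact: polyfunM.
Qed.

(** A certificate is a condition on signs of the [cone_poly j] only, so it carries over from [x] to
    [y] with the same [T]. *)
Lemma cone_poly_sg x y :
  (forall j, Num.sg (cone_poly j x) = Num.sg (cone_poly j y)) ->
  forall i, in_cone (F x) (z i) -> in_cone (F y) (z i).
Proof.
move=> sgE i /exists_cone_certificate[T [Td [det0 num0 res0]]].
(* For empty [T] the residue is a nonzero multiple of [z i]. *)
have T0 : T != finset.set0.
  apply: contraNneq (z_neq0 i) => T0; move/eqP: res0; rewrite subr_eq0 => /eqP/esym/eqP.
  suff -> : restrict_rows (F x) T = 0 by rewrite mulmx0 scaler_eq0 (negPf det0).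
  by apply/matrixP => a b; rewrite !mxE T0 inE.
have [phi phiT] := imset_ord_of_card T0 Td.
apply: (@cone_certificateP _ _ _ _ _ T).
have sgdet := sgE (phi, None); rewrite /cone_poly /= phiT in sgdet.
split.
- by rewrite -sgr_eq0 -sgdet sgr_eq0.
- move=> a; have := sgE (phi, Some (i, inl a)); rewrite /cone_poly /= phiT => sgnum.
  by rewrite -sgr_ge0 sgrM -sgnum -sgdet -sgrM sgr_ge0.
- apply/rowP => b; have := sgE (phi, Some (i, inr b)).
  rewrite /cone_poly /= phiT res0 !mxE sgr0.
  by move/esym/eqP; rewrite sgr_eq0 => /eqP.
Qed.

(** There are [k ^ d] index maps, [(n * (k + d)).+1] polynomials for each, and [2 * k] bounds the
    degrees. *)
Lemma card_cone_traces (I : finType) (x : I -> 'rV[R]_N) :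
  (forall t t',
    (forall i, in_cone (F (x t)) (z i) <-> in_cone (F (x t')) (z i)) -> t = t') ->
  (#|I| <= 2 * (2 * (k ^ d * (n * (k + d)).+1) * (2 * k)).+1 ^ N)%N.
Proof.
move=> xinj.
have -> : (k ^ d * (n * (k + d)).+1 = #|J|)%N.
  by rewrite card_prod card_ffun card_option card_prod card_sum !card_ord.
apply: (card_sign_patterns polyfun_cone_poly) => t t' tt'.
by apply: xinj => i; split; apply: cone_poly_sg.
Qed.
End ConeTraces.

(** * Convex hulls *)

Section Hull.
Context {R : realType}.

Lemma convex_setP (E : lmodType R) (M : set E) :
  convex_set (M : set (convex_lmodType E)) <->
  forall x y (p : R), 0 <= p <= 1 -> M x -> M y -> M (p *: x + (1 - p) *: y).
Proof.
split=> [cM x y p p01 Mx My|cM x y l].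
  have := @cM x y (Itv01 (proj1 (andP p01)) (proj2 (andP p01))).
  by rewrite !inE; exact.
rewrite !inE => Mx My; apply: cM => //; exact/andP.
Qed.

Lemma convex_comb_mem (E : lmodType R) (I : finType) (M : set E)
    (v : I -> E) (l : I -> R) :
  convex_set (M : set (convex_lmodType E)) ->
  (forall i, M (v i)) -> (forall i, 0 <= l i) ->
  \sum_i l i = 1 -> M (\sum_i l i *: v i).
Proof.
move=> /convex_setP cM Mv l0 l1.
(* Normalized partial sums make the induction go through with two-point combinations. *)
suff H (r : seq I) : 0 < \sum_(i <- r) l i ->
    M ((\sum_(i <- r) l i)^-1 *: \sum_(i <- r) l i *: v i).
  by have := H (index_enum I); rewrite l1 invr1 scale1r; apply.
elim: r => [|i r IHr]; first by rewrite big_nil ltxx.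
rewrite !big_cons; set S := \sum_(j <- r) l j in IHr *; set V := \sum_(j <- r) _ in IHr *.
have S0 : 0 <= S by rewrite sumr_ge0.
move=> liS; have [S_eq0|S_neq0] := eqVneq S 0.
  have -> : V = 0.
    move/eqP: S_eq0; rewrite psumr_eq0 // => /allP lr.
    by rewrite /V big_seq big1 // => j /lr /= /eqP ->; rewrite scale0r.
  rewrite S_eq0 !addr0 in liS *.
  by rewrite scalerA mulVf ?scale1r // gt_eqF.
have S_gt0 : 0 < S by rewrite lt_neqAle eq_sym S_neq0.
have n0 : l i + S != 0 by rewrite gt_eqF.
set a := l i / (l i + S).
have -> : (l i + S)^-1 *: (l i *: v i + V) = a *: v i + (1 - a) *: (S^-1 *: V).
  rewrite scalerDr !scalerA [_ * l i]mulrC; congr (_ + _ *: _).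
  by rewrite /a; field; rewrite n0 S_neq0.
apply: cM => //; last exact: IHr.
by rewrite /a divr_ge0 ?(ltW liS) //= ler_pdivrMr // mul1r lerDl.
Qed.

(** Homogenization: the extra coordinate 1 forces the coefficients to sum to 1. *)
Lemma convex_hull_range (k d : nat) (v : 'M[R]_(k, d)) (y : 'rV[R]_d) :
  convex_hull (range (fun i => row i v)) y <->
  in_cone (row_mx (const_mx 1 : 'cV_k) v) (row_mx (const_mx 1 : 'rV_1) y).
Proof.
pose lift x := row_mx (const_mx 1 : 'rV[R]_1) x : 'rV[R]_(1 + d).
have coneE (l : 'rV[R]_k) x : l *m row_mx (const_mx 1 : 'cV_k) v = lift x <->
    \sum_i l 0 i = 1 /\ \sum_i l 0 i *: row i v = x.
  rewrite mul_mx_row -mulmx_sum_row; split=> [/eq_row_mx[/rowP/(_ 0)]|[l1 ->]].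
    by rewrite !mxE => <- ->; split => //; apply: eq_bigr => i _; rewrite mxE mulr1.
  congr row_mx; apply/rowP => i; rewrite mxE [RHS]mxE -[RHS]l1.
  by apply: eq_bigr => j _; rewrite mxE mulr1.
split=> [|[l l0 /coneE[l1 <-]]]; last first.
  by move=> M [cM vM]; apply: convex_comb_mem => // i; apply: vM; exists i.
(* The hull is the smallest convex set containing the rows, so it suffices that this set is one. *)
move=> yV; apply: (yV [set x | in_cone (row_mx (const_mx 1 : 'cV_k) v) (lift x)]).
split.
  apply/convex_setP => x x' p /andP[p0 p1] [l l0 /coneE[l1 <-]] [l' l0' /coneE[l1' <-]].
  exists (p *: l + (1 - p) *: l') => [i|].
    by rewrite !mxE addr_ge0 // mulr_ge0 // subr_ge0.
  apply/coneE; split.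
    rewrite (eq_bigr (fun i => p * l 0 i + (1 - p) * l' 0 i)); last first.
      by move=> i _; rewrite !mxE.
    by rewrite big_split /= -!mulr_sumr l1 l1' !mulr1 subrKC.
  rewrite !scaler_sumr -big_split /=; apply: eq_bigr => i _.
  by rewrite !scalerA -scalerDl 3!mxE.
move=> _ [i _ <-]; exists (delta_mx 0 i) => [j|]; first by rewrite mxE ler0n.
by rewrite -rowE row_row_mx; congr row_mx; apply/rowP => j; rewrite !mxE.
Qed.

Lemma polytopes_range (k d : nat) (P : set 'rV[R]_d) : polytopes k P -> P !=set0 ->
  exists v : 'M[R]_(k, d), P = convex_hull (range (fun i => row i v)).
Proof.
move=> [V /pcard_surjP[g gV] <-] [y Vy].
have [v0 Vv0] : V !=set0.
  apply/set0P; apply: contraPneq Vy => -> /(_ set0); apply.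
  by split => // x x' l; rewrite inE.
(* [g] covers [V] but may leave it; stray values are replaced by [v0], which exists because the hull
   of the empty set is empty. *)
exists (\matrix_i (if `[< V (g i) >] then g i else v0)); congr convex_hull.
apply/seteqP; split => [x Vx|_ [i _ <-]]; last by rewrite rowK; case: asboolP.
have [i ik gi] := gV _ Vx.
by exists (Ordinal ik) => //; rewrite rowK /= gi; case: asboolP.
Qed.

End Hull.

(** * Counting traces *)

Lemma sub_shattered (T : Type) (F : set (set T)) (Y Z : set T) :
  Z `<=` Y -> shattered F Y -> shattered F Z.
Proof.
move=> ZY FY Y' Y'Z; have [F' FF' F'Y] := FY Y' (subset_trans Y'Z ZY).
exists F' => //; rewrite -(setIidr ZY) setIA F'Y; exact/setIidl.
Qed.

Lemma shattered_traces (T : Type) (F : set (set T)) n (y : 'I_n -> T) :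
  injective y -> shattered F (range y) ->
  forall A : {set 'I_n}, exists2 P, F P & forall i, P (y i) <-> i \in A.
Proof.
move=> y_inj shF A; have [|P FP PE] := shF (y @` [set` A]).
  exact: image_subset.
exists P => // i; split=> [Pi|iA].
  have : (P `&` range y) (y i) by split => //; exists i.
  by rewrite PE => -[j jA /y_inj <-].
have : (y @` [set` A]) (y i) by exists i.
by rewrite -PE => -[].
Qed.

Section Counting.
Context {R : realType}.

Lemma expn2_le_of_shattered d k n (y : 'I_n -> 'rV[R]_d) :
  (0 < k)%N -> injective y -> shattered (@polytopes R d k) (range y) ->
  (2 ^ n <=
     (2 * (2 * (k ^ (1 + d) * (n * (k + (1 + d))).+1) * (2 * k)).+1
       ^ (k * d)).+1)%N.
Proof.
move=> k0 y_inj /(shattered_traces y_inj) traces.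
(* The empty trace may come from the empty polytope, which has no matrix of [k] vertices; the final
   [.+1] counts it. *)
pose I := {A : {set 'I_n} | A != finset.set0}.
have <- : #|{: I}|.+1 = (2 ^ n)%N.
  rewrite card_sig -[in RHS](card_ord n) -cardsT -card_powerset powersetT cardsT.
  rewrite [RHS](cardD1 finset.set0) add1n; congr _.+1.
  by apply: eq_card => A; rewrite !inE andbT.
rewrite ltnS.
pose F (x : 'rV[R]_(k * d)) := row_mx (const_mx 1 : 'cV_k) (vec_mx x).
pose z i := row_mx (const_mx 1 : 'rV[R]_1) (y i).
have /fin_all_exists[v vP] (A : I) :
    exists v : 'M[R]_(k, d), forall i, in_cone (F (mxvec v)) (z i) <-> i \in val A.
  have [P kP PA] := traces (val A).
  have /set0Pn[a aA] := valP A.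
  have [|v PE] := polytopes_range kP; first by exists (y a); exact/PA.
  by exists v => i; rewrite /F mxvecK -convex_hull_range -PE.
apply: (@card_cone_traces R _ k (1 + d) n F z k0 _ _ _ (fun A => mxvec (v A)))
  => [i j|i|A B AB].
- rewrite -(splitK j); case: (fintype.split j) => b /=.
    by apply: eq_polyfun (polyfun_cst 1 1) => x; rewrite row_mxEl mxE.
  by apply: eq_polyfun (polyfun_coord (mxvec_index i b)) => x; rewrite row_mxEr mxE.
- apply/negP => /eqP/rowP/(_ (lshift d ord0)); rewrite row_mxEl !mxE => /eqP.
  by rewrite oner_eq0.
- by apply/val_inj/setP => i; apply/idP/idP => /vP /AB /vP.
Qed.

(** Of three points on a line, the middle one lies in every convex set containing the other two. *)
Lemma card_shattered_dim1 k n (y : 'I_n -> 'rV[R]_1) :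
  injective y -> shattered (@polytopes R 1 k) (range y) -> (n <= 2)%N.
Proof.
move=> y_inj /(shattered_traces y_inj) traces; rewrite leqNgt; apply/negP => n2.
pose i0 : 'I_n := Ordinal (ltnW (ltnW n2)).
pose i := [arg min_(a < i0) y a 0 0]%O; pose m := [arg max_(a > i0) y a 0 0]%O.
have imin a : y i 0 0 <= y a 0 0 by rewrite /i; case: arg_minP => // b _; exact.
have mmax a : y a 0 0 <= y m 0 0 by rewrite /m; case: arg_maxP => // b _; exact.
have /subsetPn[j _] : ~~ ([set: 'I_n]%SET \subset [set i; m]%SET).
  apply/negP => /subset_leq_card; rewrite cardsT card_ord cards2 leqNgt => /negP; apply.
  by rewrite (leq_ltn_trans _ n2) //; case: (_ != _).
have yE a b : y a 0 0 = y b 0 0 -> a = b.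
  by move=> yab; apply/y_inj/rowP => c; rewrite !ord1.
rewrite !inE negb_or => /andP[ji jm].
have yij : y i 0 0 < y j 0 0 by rewrite lt_neqAle imin andbT; apply: contra_neq ji => /yE.
have yjm : y j 0 0 < y m 0 0 by rewrite lt_neqAle mmax andbT; apply: contra_neq jm => /yE.
have [P [V _ <-] PA] := traces [set i; m]%SET.
suff /PA : convex_hull V (y j) by rewrite !inE (negPf ji) (negPf jm).
have /PA Pi : i \in [set i; m]%SET by rewrite !inE eqxx.
have /PA Pm : m \in [set i; m]%SET by rewrite !inE eqxx orbT.
pose p := (y m 0 0 - y j 0 0) / (y m 0 0 - y i 0 0).
have den : 0 < y m 0 0 - y i 0 0 by lra.
have -> : y j = p *: y i + (1 - p) *: y m.
  by apply/rowP => c; rewrite !ord1 !mxE /p; field; rewrite gt_eqF.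
move=> M VM; have [/convex_setP cM _] := VM; apply: cM; last 2 first.
- exact: Pi.
- exact: Pm.
by rewrite /p ler_pdivrMr // mul1r divr_ge0 ?(ltW den) //=; lra.
Qed.

(** * Base-2 logarithms and the final inequality *)

Lemma log2M : {in Num.pos &, {morph (@log2 R) : x y / x * y >-> x + y}}.
Proof. by move=> x y x0 y0; rewrite /log2 lnM // mulrDl. Qed.

Lemma log2X n (x : R) : 0 < x -> log2 (x ^+ n) = n%:R * log2 x.
Proof. by move=> x0; rewrite /log2 lnXn // -[ln x *+ n]mulr_natl mulrA. Qed.

Lemma ln2_gt0 : 0 < ln 2 :> R.
Proof. by rewrite ln_gt0 // ltr1n. Qed.

Lemma log22 : log2 (2 : R) = 1.
Proof. by rewrite /log2 divff // gt_eqF // ln2_gt0. Qed.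

Lemma ler_log2 (x y : R) : 0 < x -> x <= y -> log2 x <= log2 y.
Proof.
move=> x0 xy; rewrite /log2 ler_pM2r ?invr_gt0 ?ln2_gt0 //.
by rewrite ler_ln ?posrE // (lt_le_trans x0).
Qed.

Lemma ln2_ge : 2^-1 <= ln 2 :> R.
Proof.
have := @le_ln1Dx R (- 2^-1); have -> : 1 + - 2^-1 = 2^-1 :> R by lra.
by rewrite lnV ?posrE // lerN2; apply; lra.
Qed.

(** From [ln (x / 16) <= x / 16 - 1], whose right-hand side is nonnegative, and [1 / ln 2 <= 2]. *)
Lemma log2_le_linear (x : R) : 16 <= x -> log2 x <= 2 + x / 8.
Proof.
move=> x16; have l2 := ln2_ge; have l0 := ln2_gt0.
rewrite /log2 ler_pdivrMr //.
have x0 : 0 < x by lra.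
have := @le_ln1Dx R (x / 16 - 1); rewrite subrKC.
have -> : ln (x / 16) = ln x - ln 2 *+ 4.
  rewrite ln_div ?posrE // -lnXn //; congr (_ - ln _).
  by rewrite -natrX.
rewrite -mulr_natr => /(_ _)/wrap[|lx]; first by lra.
nra.
Qed.

(* Writing [n = x k d], the logarithm of the hypothesis bounds [x] by
   [d * log2 k + log2 x] up to lower order terms. *)
Lemma shattered_arith d k n : (1 < d)%N -> (1 < k)%N ->
  (2 ^ n <=
     (2 * (2 * (k ^ (1 + d) * (n * (k + (1 + d))).+1) * (2 * k)).+1
       ^ (k * d)).+1)%N ->
  n%:R <= 8 * d%:R ^+ 2 * k%:R * log2 (k%:R : R).
Proof.
move=> d1 k1 n_le; rewrite leNgt; apply/negP => n_gt.
pose L := log2 (k%:R : R).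
have L1 : 1 <= L by rewrite -log22 ler_log2 // ler_nat.
have dR : 2 <= d%:R :> R by rewrite ler_nat.
have kR : 2 <= k%:R :> R by rewrite ler_nat.
have kd4 : 4 <= (k * d)%:R :> R by rewrite ler_nat; nia.
pose x := n%:R / (k * d)%:R : R.
have nE : n%:R = x * (k * d)%:R by rewrite /x divfK // gt_eqF //; lra.
have x_gt : 8 * d%:R * L < x.
  rewrite /x ltr_pdivlMr; last by lra.
  by apply: le_lt_trans n_gt; rewrite natrM /L; lra.
clearbody x.
have dL : 2 * L <= d%:R * L by rewrite ler_pM2r //; lra.
have dL' : d%:R <= d%:R * L by rewrite ler_peMr //; lra.
have x16 : 16 <= x by lra.
have n2 : (1 < n)%N by rewrite -(ltr_nat R) nE; nra.
(* The bound [k + d + 2 <= 2 * k * d] together with [n >= 2] absorbs the successors in the base; the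
   factor 4 absorbs the outer one. *)
have {}n_le : (2 ^ n <= 4 * (8 * d * n * k ^ (d + 3)) ^ (k * d))%N.
  have base : ((2 * (k ^ (1 + d) * (n * (k + (1 + d))).+1) * (2 * k)).+1
               <= 8 * d * n * k ^ (d + 3))%N.
    have kd : (k + d + 2 <= 2 * (k * d))%N by nia.
    have -> : (k ^ (d + 3) = k ^ (1 + d) * k * k)%N by rewrite addnC -!expnSr.
    have K0 : (0 < k ^ (1 + d))%N by rewrite expn_gt0; lia.
    move: (k ^ (1 + d))%N K0 => K K0.
    have nkd : (n * (k + d + 2) <= n * (2 * (k * d)))%N by rewrite leq_mul2l kd orbT.
    have Kk : (0 < K * k)%N by rewrite muln_gt0 K0; lia.
    rewrite (_ : 2 * _ * _ = (K * k) * (4 * (n * (k + (1 + d))).+1))%N; last by ring.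
    rewrite (_ : 8 * d * n * _ = (K * k) * (4 * (n * (2 * (k * d)))))%N; last by ring.
    by rewrite (leq_trans (n := ((K * k) * (4 * (n * (k + (1 + d))).+1 + 1))%N)) //; nia.
  apply: (leq_trans n_le); set X := (_.+1 ^ _)%N; set Z := (_ ^ (k * d))%N.
  have XZ : (X <= Z)%N by rewrite leq_exp2r //; lia.
  have X0 : (0 < X)%N by rewrite expn_gt0.
  lia.
have d0 : (0 < d)%N by lia.
have log_d : log2 (d%:R : R) <= d%:R - 1.
  apply: (@le_trans _ _ (log2 (2 ^+ d.-1))).
    by rewrite ler_log2 ?ltr0n // -natrX ler_nat -{1}(prednK d0) ltn_expl.
  by rewrite log2X // log22 mulr1 -[in leRHS](prednK d0) -natr1 addrK.
have [x0 dR0 kR0 nR0] : [/\ 0 < x, 0 < d%:R :> R, 0 < k%:R :> R & 0 < n%:R :> R].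
  by split; rewrite ?ltr0n; [lra|lia|lia|lia].
have log_n : log2 (n%:R : R) = log2 x + L + log2 (d%:R : R).
  by rewrite nE natrM !log2M ?posrE ?mulr_gt0 // addrA.
have log_x := log2_le_linear x16.
have log4 : log2 (4 : R) = 2 by rewrite (_ : 4 = 2 ^+ 2) ?log2X ?log22 ?mulr1 // -natrX.
have log8 : log2 (8 : R) = 3 by rewrite (_ : 8 = 2 ^+ 3) ?log2X ?log22 ?mulr1 // -natrX.
have two_pow0 : 0 < (2 ^ n)%:R :> R by rewrite ltr0n expn_gt0.
have : log2 (2 ^ n)%:R <= log2 (4 * (8 * d * n * k ^ (d + 3)) ^ (k * d))%:R :> R.
  by rewrite ler_log2 // ler_nat.
have base0 : 0 < (8 * d * n * k ^ (d + 3))%:R :> R.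
  by rewrite !natrM natrX !mulr_gt0 ?exprn_gt0.
rewrite natrM !natrX log2M ?posrE ?exprn_gt0 // !log2X // log22 mulr1 log4.
have -> : log2 (8 * d * n * k ^ (d + 3))%:R =
    3 + log2 d%:R + log2 n%:R + (d%:R + 3) * L :> R.
  by rewrite !natrM natrX !log2M ?posrE ?mulr_gt0 ?exprn_gt0 // log2X // log8 natrD.
rewrite log_n nE => main.
(* Here [11 / 2] is 3 from [log8], 2 from [log_x], and [1 / 2] since the additive 2 is at most half
   of [k * d >= 4]. *)
have : x * (k * d)%:R <= (k * d)%:R * (11 / 2 + 2 * (d%:R - 1) + x / 8 + (d%:R + 4) * L).
  apply: (le_trans main).
  set B := (k * d)%:R in kd4 *.
  have e1 : B * (3 + log2 d%:R + (log2 x + L + log2 d%:R) + (d%:R + 3) * L) <=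
            B * (5 + 2 * (d%:R - 1) + x / 8 + (d%:R + 4) * L).
    by rewrite ler_wpM2l //; lra.
  lra.
(* What remains gives [7 * x / 8 <= 7 / 2 + 2 * d + (d + 4) * L <= 7 / 2 + 5 * d * L], against
   [x > 8 * d * L] and [d * L >= 2]. *)
rewrite mulrC ler_pM2l; last by lra.
lra.
Qed.
End Counting.

Lemma card_shattered_polytopes (R : realType) d k n (y : 'I_n -> 'rV[R]_d) :
  (0 < d)%N -> (1 < k)%N -> injective y -> shattered (@polytopes R d k) (range y) ->
  n%:R <= 8 * d%:R ^+ 2 * k%:R * log2 (k%:R : R).
Proof.
move=> d0 k1 y_inj shY; have [d1|d1] := ltnP 1 d.
  by apply: shattered_arith => //; apply: expn2_le_of_shattered shY => //; lia.
have {d0 d1} d1 : d = 1%N by lia.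
subst d; have n2 := card_shattered_dim1 y_inj shY.
have kR : 2 <= k%:R :> R by rewrite ler_nat.
have L1 : 1 <= log2 (k%:R : R) by rewrite -[leLHS]log22 ler_log2.
have nR : n%:R <= 2 :> R by rewrite ler_nat.
nra.
Qed.

Theorem theorem2 (R : realType) (d k : nat) (hd : (0 < d)%N) (hk : (1 < k)%N) :
  (VC_dim R (@polytopes R d k)
     <= (8 * d%:R ^+ 2 * k%:R * log2 (k%:R : R))%:E)%E.
Proof.
apply: ub_ereal_sup => _ [Y shY <-].
set b := 8 * _ * _ * _.
(* Bounding finite subsets of [Y] also excludes an infinite [Y], which would contain more than [b]
   points. *)
have card_le (B : seq 'rV[R]_d) : uniq B -> {in B, forall x, Y x} -> (size B)%:R <= b.
  move=> uB BY; pose y (i : 'I_(size B)) := nth 0 B i.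
  apply: (@card_shattered_polytopes R d k _ y) => //.
    by move=> i j /eqP; rewrite nth_uniq // => /eqP/val_inj.
  by apply: sub_shattered shY => _ [i _ <-]; apply: BY; exact: mem_nth.
rewrite /counting; case: asboolP => [finY|/infinite_set_fset infY].
  rewrite lee_fin; apply: card_le (finmap.fset_uniq _) _ => x.
  by rewrite in_fset_set // inE.
have [B BY] := infY (Num.trunc b).+1; have Bb := card_le _ (finmap.fset_uniq B) BY.
rewrite leqNgt => /negP[]; rewrite -(ltr_nat R).
by apply: le_lt_trans Bb (truncnS_gt _).
Qed.
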